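(* Let $n\in\mathbb{N}$. There is an isomorphism of categories $Pol_n(mon,Ab)\cong Pol_n(gr,Ab)$ between the category of reduced polynomial functors of degree $n$ (i.e. lower or equal to $n$) from finitely generated free monoids to abelian groups and the category of reduced polynomial functors of degree $n$ (i.e. lower or equal to $n$) from finitely generated free groups to abelian groups.
   Context: $mon$ (resp. $gr$) denotes the full subcategory of the category of monoids with unit (resp. of groups) whose objects are the free monoids (resp. free groups) on the sets $\underline{m}=\{1,\dots,m\}$, $m\ge0$. Both are pointed categories with finite coproducts, denoted $\vee$. Let $\mathcal{C}$ be a pointed category (null object $0$) with finite coproducts $\vee$. A functor $F:\mathcal{C}\to Ab$ is reduced if $F(0)=0$. For $m\ge1$ its $m$-th cross-effect is $$cr_mF(X_1,\dots,X_m)=\ker\Big(F(X_1\vee\cdots\vee X_m)\to\bigoplus_{k=1}^mF(X_1\vee\cdots\vee\widehat{X_k}\vee\cdots\vee X_m)\Big),$$ the components being induced by the retractions killing the $k$-th summand. $F$ is polynomial of degree lower or equal to $n$ if $cr_{n+1}F=0$. $Pol_n(\mathcal{C},Ab)$ is the full subcategory of the category of functors $\mathcal{C}\to Ab$ on the reduced polynomial functors of degree lower or equal to $n$. *)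

(* Defs.v *)
From HB Require Import structures.
From mathcomp Require Import all_boot all_order all_algebra.
From mathcomp Require Import boolp classical_sets.

Set Implicit Arguments.
Unset Strict Implicit.
Unset Printing Implicit Defensive.

Declare Scope category_scope.
Delimit Scope category_scope with cat.
Local Open Scope category_scope.

Record category := Category {
  obj :> Type;
  hom : obj -> obj -> Type;
  idm : forall X, hom X X;
  comp : forall X Y Z, hom Y Z -> hom X Y -> hom X Z;
  comp_idl : forall X Y (f : hom X Y), comp (idm Y) f = f;
  comp_idr : forall X Y (f : hom X Y), comp f (idm X) = f;
  compA : forall W X Y Z (h : hom Y Z) (g : hom X Y) (f : hom W X),
    comp h (comp g f) = comp (comp h g) f }.

Arguments idm {c} X.
Notation "g \oc f" := (comp g f) (at level 50, left associativity)
  : category_scope.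

Record functor (C D : category) := Functor {
  fobj :> C -> D;
  fmap : forall X Y, hom X Y -> hom (fobj X) (fobj Y);
  fmap_id : forall X, fmap (idm X) = idm (fobj X);
  fmap_comp : forall X Y Z (g : hom Y Z) (f : hom X Y),
    fmap (g \oc f) = fmap g \oc fmap f }.

Arguments fmap {C D} _ {X Y} _.

Section FunctorComposition.
Variables C D E : category.

Definition functor_id : functor C C :=
  @Functor C C id (fun _ _ => id) (fun _ => erefl) (fun _ _ _ _ _ => erefl).

Variables (G : functor D E) (F : functor C D).

Lemma functor_comp_id X : fmap G (fmap F (idm X)) = idm (G (F X)).
Proof. by rewrite !fmap_id. Qed.

Lemma functor_comp_comp X Y Z (g : hom Y Z) (f : hom X Y) :
  fmap G (fmap F (g \oc f)) = fmap G (fmap F g) \oc fmap G (fmap F f).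
Proof. by rewrite !fmap_comp. Qed.

Definition functor_comp : functor C E :=
  @Functor C E (fun X => G (F X)) (fun _ _ f => fmap G (fmap F f))
    functor_comp_id functor_comp_comp.

End FunctorComposition.

Definition isomorphic_categories (C D : category) : Prop :=
  exists (P : functor C D) (Q : functor D C),
    functor_comp Q P = functor_id C /\ functor_comp P Q = functor_id D.

Record nat_trans (C D : category) (F G : functor C D) := NatTrans {
  component :> forall X, hom (F X) (G X);
  naturality : forall X Y (f : hom X Y),
    component Y \oc fmap F f = fmap G f \oc component X }.

Section FunctorCategory.
Variables C D : category.

Lemma nat_trans_ext (F G : functor C D) (s t : nat_trans F G) :
  (forall X, s X = t X) -> s = t.
Proof.
case: s t => [s sN] [t tN] /= st; have e : s = t by exact: functional_extensionality_dep.
by case: _ / e in tN *; congr NatTrans; exact: Prop_irrelevance.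
Qed.

Lemma nat_id_natural (F : functor C D) X Y (f : hom X Y) :
  idm (F Y) \oc fmap F f = fmap F f \oc idm (F X).
Proof. by rewrite comp_idl comp_idr. Qed.

Definition nat_id (F : functor C D) : nat_trans F F :=
  NatTrans (@nat_id_natural F).

Lemma nat_comp_natural (F G H : functor C D)
    (t : nat_trans G H) (s : nat_trans F G) X Y (f : hom X Y) :
  (t Y \oc s Y) \oc fmap F f = fmap H f \oc (t X \oc s X).
Proof. by rewrite -compA naturality compA naturality compA. Qed.

Definition nat_comp (F G H : functor C D)
    (t : nat_trans G H) (s : nat_trans F G) : nat_trans F H :=
  NatTrans (nat_comp_natural t s).

Definition functor_category : category.
Proof.
refine (@Category (functor C D) (@nat_trans C D) nat_id nat_comp _ _ _).
- by move=> F G s; apply: nat_trans_ext => X /=; rewrite comp_idl.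
- by move=> F G s; apply: nat_trans_ext => X /=; rewrite comp_idr.
- by move=> F G H K u t s; apply: nat_trans_ext => X /=; rewrite compA.
Defined.

End FunctorCategory.

(* The full subcategory of C on the objects U i.  For an injective U this is
   the usual notion; the objects are named by their index. *)
Definition full_subcategory (C : category) (I : Type) (U : I -> C) : category :=
  @Category I (fun i j => hom (U i) (U j)) (fun i => idm (U i))
    (fun i j k => @comp C (U i) (U j) (U k))
    (fun i j => @comp_idl C (U i) (U j)) (fun i j => @comp_idr C (U i) (U j))
    (fun i j k l => @compA C (U i) (U j) (U k) (U l)).

Lemma additive_ext (A B : zmodType) (f g : {additive A -> B}) :
  f =1 g -> f = g.
Proof.
case: f g => [f [[fP]]] [g [[gP]]] /= fg.
have e : f = g by exact: funext.
by case: _ / e in gP *; rewrite (Prop_irrelevance fP gP).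
Qed.

Lemma monoid_hom_ext (M N : baseUMagmaType) (f g : UMagmaMorphism.type M N) :
  f =1 g -> f = g.
Proof.
case: f g => [f [[f1] [fM]]] [g [[g1] [gM]]] /= fg.
have e : f = g by exact: funext.
case: _ / e in g1 gM *.
by rewrite (Prop_irrelevance f1 g1) (Prop_irrelevance fM gM).
Qed.

(* The equality test and choice operator that zmodType, monoidType and
   groupType carry exist classically on every type and are ignored by
   morphisms. *)
Definition Ab : category.
Proof.
refine (@Category zmodType (fun A B => {additive A -> B})
  (fun A => [the {additive A -> A} of idfun])
  (fun A B C g f => [the {additive A -> C} of g \o f]) _ _ _) => *;
exact: additive_ext.
Defined.

Definition Mon : category.
Proof.
refine (@Category monoidType (fun M N => UMagmaMorphism.type M N)
  (fun M => [the UMagmaMorphism.type M M of idfun])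
  (fun M N P g f => [the UMagmaMorphism.type M P of g \o f]) _ _ _) => *;
exact: monoid_hom_ext.
Defined.

Definition Grp : category.
Proof.
refine (@Category groupType (fun G H => UMagmaMorphism.type G H)
  (fun G => [the UMagmaMorphism.type G G of idfun])
  (fun G H K g f => [the UMagmaMorphism.type G K of g \o f]) _ _ _) => *;
exact: monoid_hom_ext.
Defined.

Record pointed_category := PointedCategory {
  pcat :> category;
  zero : pcat;
  from_zero : forall X, hom zero X;
  to_zero : forall X, hom X zero;
  from_zero_uniq : forall X (f : hom zero X), f = from_zero X;
  to_zero_uniq : forall X (f : hom X zero), f = to_zero X;
  coprod : forall m, ('I_m -> pcat) -> pcat;
  inj : forall m (X : 'I_m -> pcat) i, hom (X i) (coprod X);
  copair : forall m (X : 'I_m -> pcat) Y,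
    (forall i, hom (X i) Y) -> hom (coprod X) Y;
  copair_inj : forall m (X : 'I_m -> pcat) Y (f : forall i, hom (X i) Y) i,
    copair f \oc inj X i = f i;
  copair_uniq : forall m (X : 'I_m -> pcat) Y (f g : hom (coprod X) Y),
    (forall i, f \oc inj X i = g \oc inj X i) -> f = g }.

Arguments coprod {p m} X.
Arguments inj {p m} X i.
Arguments copair {p m X Y} f.
Arguments zero {p}.

Section CrossEffects.
Local Open Scope classical_set_scope.
Variable C : pointed_category.

Definition zero_map (X Y : C) : hom X Y := from_zero Y \oc to_zero X.

Section Retraction.
Variables (m : nat) (X : 'I_m.+1 -> C) (k : 'I_m.+1).

Definition omit : 'I_m -> C := fun j => X (lift k j).

(* The k-th summand is sent to the zero object, the others to themselves; see
   retraction_inj0 and retraction_inj. *)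
Definition retraction_component (i : 'I_m.+1) : hom (X i) (coprod omit) :=
  match unliftP k i with
  | UnliftSome j e =>
      ecast i0 (hom (X i0) (coprod omit)) (esym e) (inj omit j)
  | UnliftNone _ => zero_map (X i) (coprod omit)
  end.

Definition retraction : hom (coprod X) (coprod omit) :=
  copair retraction_component.

Lemma retraction_inj j : retraction \oc inj X (lift k j) = inj omit j.
Proof.
rewrite /retraction copair_inj /retraction_component.
case: unliftP => [j' e|e]; last by case: (elimN eqP (neq_lift k j)).
by have ejj' := lift_inj e; case: _ / ejj' in e *; rewrite eq_axiomK.
Qed.

Lemma retraction_inj0 :
  retraction \oc inj X k = zero_map (X k) (coprod omit).
Proof.
rewrite /retraction copair_inj /retraction_component.
by case: unliftP => // j e; case: (elimN eqP (neq_lift k j)).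
Qed.

End Retraction.

Variable F : functor C Ab.

Definition reduced : Prop := forall x : (F zero : zmodType), x = 0%R.

(* The kernel of a map into a finite direct sum is the set of elements killed
   by all of its components. *)
Definition cross_effect (m : nat) (X : 'I_m.+1 -> C) :
    set (F (coprod X) : zmodType) :=
  [set x | forall k : 'I_m.+1,
             (fmap F (retraction X k) : {additive _ -> _}) x = 0%R].

Arguments cross_effect {m} X _.

Definition polynomial (n : nat) : Prop :=
  forall X : 'I_n.+1 -> C, cross_effect X = [set 0%R].

End CrossEffects.

Arguments cross_effect {C} F {m} X _.

Definition Pol (n : nat) (C : pointed_category) : category :=
  @full_subcategory (functor_category C Ab)
    {F : functor C Ab | reduced F /\ polynomial F n} sval.

(* The free object on the empty set is required to be a point, so that it is
   terminal as well as initial in the full subcategory of free objects. *)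
Record free_objects := FreeObjects {
  ambient : category;
  elt : ambient -> Type;
  app : forall X Y, hom X Y -> elt X -> elt Y;
  app_comp : forall X Y Z (g : hom Y Z) (f : hom X Y) x,
    app (g \oc f) x = app g (app f x);
  free : nat -> ambient;
  gen : forall m, 'I_m -> elt (free m);
  extend : forall m Y, ('I_m -> elt Y) -> hom (free m) Y;
  extend_gen : forall m Y (u : 'I_m -> elt Y) i, app (extend u) (gen i) = u i;
  gen_ext : forall m Y (f g : hom (free m) Y),
    (forall i, app f (gen i) = app g (gen i)) -> f = g;
  base : elt (free 0);
  base_uniq : forall x, x = base }.

Arguments app {f X Y} _ _ : rename.
Arguments gen {f m} i : rename.
Arguments extend {f m Y} u : rename.

Section FreeCategory.
Variable A : free_objects.

Let C := full_subcategory (@free A).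

Definition free_coprod m (X : 'I_m -> nat) : nat := \sum_(i < m) X i.

Definition free_inj m (X : 'I_m -> nat) (i : 'I_m) :
    @hom C (X i) (free_coprod X) :=
  extend (fun j => gen (tagnat.Rank i j)).

Definition free_copair m (X : 'I_m -> nat) (Y : nat)
    (f : forall i, @hom C (X i) Y) : @hom C (free_coprod X) Y :=
  extend (fun s => app (f (tagnat.sig1 s)) (gen (tagnat.sig2 s))).

Lemma free_copair_inj m (X : 'I_m -> nat) (Y : nat)
    (f : forall i, @hom C (X i) Y) i :
  @comp C _ _ _ (free_copair f) (free_inj X i) = f i.
Proof.
apply: gen_ext => j; rewrite app_comp !extend_gen.
by rewrite /tagnat.sig2 /tagnat.sig1 /tagnat.Rank tagnat.rankK.
Qed.

Lemma free_copair_uniq m (X : 'I_m -> nat) (Y : nat)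
    (f g : @hom C (free_coprod X) Y) :
  (forall i, @comp C _ _ _ f (free_inj X i) = @comp C _ _ _ g (free_inj X i)) ->
  f = g.
Proof.
move=> fg; apply: gen_ext => s; rewrite -(tagnat.sig2K s).
set i := tagnat.sig1 s; set j := tagnat.sig2 s.
have /(congr1 (fun h => app h (gen j))) := fg i.
by rewrite !app_comp !extend_gen.
Qed.

Definition free_from_zero (X : nat) : @hom C 0 X :=
  extend (fun i : 'I_0 => False_rect _ (notF (valP i))).

Definition free_to_zero (X : nat) : @hom C X 0 := extend (fun=> base A).

Lemma free_from_zero_uniq X (f : @hom C 0 X) : f = free_from_zero X.
Proof. by apply: gen_ext => -[]. Qed.

Lemma free_to_zero_uniq X (f : @hom C X 0) : f = free_to_zero X.
Proof. by apply: gen_ext => i; rewrite !(base_uniq (app _ _)). Qed.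

Definition free_category : pointed_category :=
  @PointedCategory C 0 free_from_zero free_to_zero
    free_from_zero_uniq free_to_zero_uniq
    free_coprod free_inj free_copair free_copair_inj free_copair_uniq.

End FreeCategory.

Definition free_monoid (m : nat) : Type := seq 'I_m.

HB.instance Definition _ m := Choice.on (free_monoid m).
HB.instance Definition _ m :=
  isMonoid.Build (free_monoid m) (@catA 'I_m) (@cat0s 'I_m) (@cats0 'I_m).

Section FreeMonoid.
Local Open Scope group_scope.
Variable m : nat.

Definition free_monoid_gen (i : 'I_m) : free_monoid m := [:: i].

Section Extension.
Variables (M : monoidType) (u : 'I_m -> M).

Definition free_monoid_val (w : free_monoid m) : M := \prod_(i <- w) u i.

Lemma free_monoid_val_morphism : monoid_morphism free_monoid_val.
Proof.
split; first exact: big_nil.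
by move=> v w; rewrite /free_monoid_val big_cat.
Qed.

HB.instance Definition _ :=
  isUMagmaMorphism.Build (free_monoid m) M free_monoid_val
    free_monoid_val_morphism.

Definition free_monoid_extend : UMagmaMorphism.type (free_monoid m) M :=
  [the UMagmaMorphism.type _ _ of free_monoid_val].

Lemma free_monoid_extend_gen i : free_monoid_extend (free_monoid_gen i) = u i.
Proof. exact: big_seq1. Qed.

End Extension.

Lemma free_monoid_gen_ext (M : monoidType)
    (f g : UMagmaMorphism.type (free_monoid m) M) :
  (forall i, f (free_monoid_gen i) = g (free_monoid_gen i)) -> f = g.
Proof.
move=> fg; apply: monoid_hom_ext; elim=> [|i w IH].
  by rewrite -[[::]]/(1 : free_monoid m) !gmulf1.
by rewrite -[i :: w]/(free_monoid_gen i * (w : free_monoid m)) !gmulfM fg IH.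
Qed.

End FreeMonoid.

Definition free_monoids : free_objects.
Proof.
refine (@FreeObjects Mon (fun M => (M : monoidType))
  (fun M N f => (f : UMagmaMorphism.type M N)) _
  (fun m => [the monoidType of free_monoid m]) free_monoid_gen
  (fun m M u => @free_monoid_extend m M u) _ _ (1%g : free_monoid 0) _).
- by [].
- by move=> m M u i; exact: free_monoid_extend_gen.
- by move=> m M f g; exact: free_monoid_gen_ext.
- by case=> // -[].
Defined.

Definition mon : pointed_category := free_category free_monoids.

(* The letter (i, false) stands for the generator i, (i, true) for its
   inverse. *)
Definition letter (m : nat) : Type := 'I_m * bool.

HB.instance Definition _ m := Choice.on (letter m).

Section ReducedWords.
Variable m : nat.
Implicit Types (a b : letter m) (w : seq (letter m)).

Definition letter_inv a : letter m := (a.1, ~~ a.2).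

Lemma letter_invK : involutive letter_inv.
Proof. by case=> i b; rewrite /letter_inv /= negbK. Qed.

Definition reduced_word w : bool := sorted (fun a b => b != letter_inv a) w.

Definition push a w : seq (letter m) :=
  if w is b :: w' then if b == letter_inv a then w' else a :: w else [:: a].

Lemma push_reduced a w : reduced_word w -> reduced_word (push a w).
Proof.
case: w => [|b w] //= bw; case: eqP => [_|/eqP ba]; last by rewrite /= ba.
exact: path_sorted bw.
Qed.

Lemma pushK a w : reduced_word w -> push a (push (letter_inv a) w) = w.
Proof.
case: w => [|b w] /=; first by rewrite eqxx.
rewrite letter_invK; case: eqP => [-> | _ _]; last by rewrite /= eqxx.
by case: w => [|c w] //= /andP[/negPf-> _].
Qed.

Lemma push_id a w : reduced_word (a :: w) -> push a w = a :: w.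
Proof. by case: w => [|b w] //= /andP[/negPf->]. Qed.

Lemma foldr_push_reduced v w :
  reduced_word w -> reduced_word (foldr push w v).
Proof. by move=> ww; elim: v => //= a v; exact: push_reduced. Qed.

Lemma foldr_push_push a v w : reduced_word w ->
  foldr push w (push a v) = push a (foldr push w v).
Proof.
move=> ww; case: v => [|b v] //=; case: eqP => [->|_] //=.
by rewrite pushK // foldr_push_reduced.
Qed.

Lemma foldr_pushA u v w : reduced_word w ->
  foldr push (foldr push w v) u = foldr push w (foldr push v u).
Proof. by move=> ww; elim: u => //= a u ->; rewrite foldr_push_push. Qed.

Lemma foldr_push_nil w : reduced_word w -> foldr push [::] w = w.
Proof.
elim: w => //= a w IH aw; rewrite IH ?push_id //; exact: path_sorted aw.
Qed.

Definition word_inv w : seq (letter m) := rev (map letter_inv w).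

Lemma word_invK : involutive word_inv.
Proof.
move=> w; rewrite /word_inv map_rev revK -map_comp -[RHS]map_id.
by apply: eq_map => a; exact: letter_invK.
Qed.

Lemma word_inv_reduced w : reduced_word w -> reduced_word (word_inv w).
Proof.
rewrite /reduced_word rev_sorted sorted_map; apply: sub_sorted => a b /=.
by apply: contra => /eqP ->; rewrite !letter_invK.
Qed.

Lemma word_invP w : foldr push w (word_inv w) = [::].
Proof.
elim: w => // a w IH; rewrite /word_inv map_cons rev_cons foldr_rcons /=.
by rewrite letter_invK eqxx.
Qed.

End ReducedWords.

Definition free_group (m : nat) : Type := {w : seq (letter m) | reduced_word w}.

HB.instance Definition _ m := SubChoice.on (free_group m).

Section FreeGroupLaws.
Variable m : nat.
Implicit Types u v w : free_group m.

Definition free_group_one : free_group m := Sub [::] isT.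

Definition free_group_mul u v : free_group m :=
  Sub (foldr (@push m) (val v) (val u)) (foldr_push_reduced _ (valP v)).

Definition free_group_inv u : free_group m :=
  Sub (word_inv (val u)) (word_inv_reduced (valP u)).

Lemma free_group_mulA : associative free_group_mul.
Proof. by move=> u v w; apply: val_inj; rewrite /= foldr_pushA // (valP w). Qed.

Lemma free_group_mul1 : left_id free_group_one free_group_mul.
Proof. by move=> u; apply: val_inj. Qed.

Lemma free_group_mulr1 : right_id free_group_one free_group_mul.
Proof. by move=> u; apply: val_inj; rewrite /= foldr_push_nil // (valP u). Qed.

Lemma free_group_mulV :
  left_inverse free_group_one free_group_inv free_group_mul.
Proof. by move=> u; apply: val_inj; rewrite /= word_invP. Qed.

Lemma free_group_mulrV :
  right_inverse free_group_one free_group_inv free_group_mul.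
Proof.
by move=> u; apply: val_inj; rewrite /= -[X in foldr _ _ X]word_invK word_invP.
Qed.

End FreeGroupLaws.

HB.instance Definition _ m :=
  isGroup.Build (free_group m) (@free_group_mulA m) (@free_group_mul1 m)
    (@free_group_mulr1 m) (@free_group_mulV m) (@free_group_mulrV m).

Section FreeGroup.
Local Open Scope group_scope.
Variable m : nat.

Definition free_group_letter (a : letter m) : free_group m := Sub [:: a] isT.

Definition free_group_gen (i : 'I_m) : free_group m :=
  free_group_letter (i, false).

Section Extension.
Variables (G : groupType) (u : 'I_m -> G).

Definition letter_val (a : letter m) : G := if a.2 then (u a.1)^-1 else u a.1.

Definition free_group_val (w : free_group m) : G :=
  \prod_(a <- val w) letter_val a.

Lemma letter_valV a : letter_val (letter_inv a) = (letter_val a)^-1.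
Proof. by case: a => i []; rewrite /letter_val //= invgK. Qed.

Lemma push_val a w :
  \prod_(b <- push a w) letter_val b
  = letter_val a * \prod_(b <- w) letter_val b.
Proof.
case: w => [|b w] /=; first by rewrite big_seq1 big_nil mulg1.
case: eqP => [->|_]; last by rewrite big_cons.
by rewrite big_cons letter_valV mulVKg.
Qed.

Lemma free_group_val_morphism : monoid_morphism free_group_val.
Proof.
split; first exact: big_nil.
move=> [v vP] w; rewrite /free_group_val /=.
elim: v {vP} => [|a v IH] /=; first by rewrite big_nil mul1g.
by rewrite push_val IH big_cons mulgA.
Qed.

HB.instance Definition _ :=
  isUMagmaMorphism.Build (free_group m) G free_group_val
    free_group_val_morphism.

Definition free_group_extend : UMagmaMorphism.type (free_group m) G :=
  [the UMagmaMorphism.type _ _ of free_group_val].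

Lemma free_group_extend_gen i : free_group_extend (free_group_gen i) = u i.
Proof. exact: big_seq1. Qed.

End Extension.

Lemma free_group_gen_ext (G : groupType)
    (f g : UMagmaMorphism.type (free_group m) G) :
  (forall i, f (free_group_gen i) = g (free_group_gen i)) -> f = g.
Proof.
move=> fg; apply: monoid_hom_ext => -[w wP].
have fgl a : f (free_group_letter a) = g (free_group_letter a).
  case: a => i []; last exact: fg.
  have -> : free_group_letter (i, true) = (free_group_gen i)^-1.
    exact: val_inj.
  by rewrite !gmulfV fg.
elim: w wP => [|a w IH] awP.
  have -> : exist _ [::] awP = 1 :> free_group m by exact: val_inj.
  by rewrite !gmulf1.
have wP : reduced_word w by exact: path_sorted awP.
have -> : exist _ (a :: w) awP
    = free_group_letter a * (exist _ w wP : free_group m).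
  by apply: val_inj; rewrite /= push_id.
by rewrite !gmulfM fgl IH.
Qed.

End FreeGroup.

Definition free_groups : free_objects.
Proof.
refine (@FreeObjects Grp (fun G => (G : groupType))
  (fun G H f => (f : UMagmaMorphism.type G H)) _
  (fun m => [the groupType of free_group m]) (@free_group_gen)
  (fun m G u => @free_group_extend m G u) _ _ (1%g : free_group 0) _).
- by [].
- by move=> m G u i; exact: free_group_extend_gen.
- by move=> m G f g; exact: free_group_gen_ext.
- by move=> [w wP]; apply: val_inj; case: w wP => // -[[]].
Defined.

Definition gr : pointed_category := free_category free_groups.

(* Main.v *)
From HB Require Import structures.
From mathcomp Require Import all_boot all_order all_algebra.
From mathcomp Require Import boolp classical_sets.
Require Import Defs.

Set Implicit Arguments.
Unset Strict Implicit.
Unset Printing Implicit Defensive.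

(** The inclusion of words into reduced words gives a functor from free monoids
to free groups which is the identity on objects.  Restriction along it sends
polynomial functors on free groups to polynomial functors on free monoids,
because it preserves coproducts and zero maps and hence has the same
cross-effects on both sides.  Restriction turns out to be bijective on objects
and on morphisms, so that it is an isomorphism, not only an equivalence, of
categories.

Everything is read off the following statement.  Let F be polynomial of degree
at most n on free monoids and x an element of F(k).  Then there is exactly one
family of maps b_l from Hom(F_k, F_l) to F(l), F_l being the free group, that
is natural for monoid morphisms in l and sends the identity to x
([natural_family_exists], [natural_family_unique]).  The extension of F to a
morphism f of free groups is x |-> b_l(f); that it is additive in x and
functorial in f, that it is the only extension, and that transformations which
are natural for monoid morphisms are natural for group morphisms, all follow by
exhibiting two natural families with the same value at the identity.

The statement on families rests on two facts.

First, the set Hom(F_k, F_l) is the group (F_l)^k, and any family of maps from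
such a group (or from the corresponding power of the free monoid) to F(l), once
it is natural in l, consists of polynomial maps in the sense of iterated
differences: all its (n+1)-fold deviations vanish ([natural_polymap]).  Indeed
a deviation at g_0, ..., g_n is the image, under the codiagonal, of the
deviation at the copies of the g_i placed in n+1 distinct summands, and the
latter lies in the cross-effect because each retraction turns one of the entries
into 1.

Second, on maps p with vanishing d-fold differences the difference operator
D_x p (y) = p (y x) - p y is nilpotent, so the translation 1 + D_x is
invertible, with inverse the alternating sum of the powers of D_x
([unshiftK], [shiftK]).
Thus the free monoid acts on these maps by invertible operators, and the action
extends to the free group.  Applying the operator of g to the map
t |-> F(t)(x) and evaluating at 1 gives existence.  Conversely a polynomial map
on the group which vanishes on the monoid is zero, since translation by an
inverse is again an alternating sum of powers of D_x and therefore preserves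
such maps ([polymap_completion_eq0]); this gives uniqueness. *)

Import GRing.Theory.
Local Open Scope ring_scope.
Local Open Scope category_scope.

(** * Polynomial maps from a monoid to an abelian group *)

Section PolynomialMaps.
Variables (M : monoidType) (A : zmodType).
Implicit Types (x y : M) (p q : M -> A).

Definition shift x p : M -> A := fun y => p (y * x)%g.
Definition diff x p : M -> A := fun y => p (y * x)%g - p y.

(** The convention is that of degree less than [d], so that only 0 has
degree less than 0.  This makes [diff] lower the bound by one and lets the
inductions start from the zero map. *)
Fixpoint polymap (d : nat) p : Prop :=
  if d is e.+1 then forall x, polymap e (diff x p) else forall y, p y = 0.

Lemma diff_shift x p : diff x (shift x p) = shift x (diff x p).
Proof. by []. Qed.

Lemma polymapB d p q :
  polymap d p -> polymap d q -> polymap d (fun y => p y - q y).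
Proof.
elim: d p q => [|d IH] p q /= pP qP; first by move=> y; rewrite pP qP subr0.
move=> x; have := IH _ _ (pP x) (qP x); congr polymap; apply: funext => y.
by rewrite /diff !opprD !opprK addrACA.
Qed.

Lemma polymap0 d : polymap d (fun=> 0).
Proof.
elim: d => //= d IH x; have -> // : diff x (fun=> 0) = fun=> 0.
by apply: funext => y; rewrite /diff subr0.
Qed.

Lemma polymapD d p q :
  polymap d p -> polymap d q -> polymap d (fun y => p y + q y).
Proof.
move=> pP qP; have := polymapB pP (polymapB (polymap0 d) qP).
by congr polymap; apply: funext => y; rewrite sub0r opprK.
Qed.

Lemma polymapW d p : polymap d p -> polymap d.+1 p.
Proof.
elim: d p => [|d IH] p pP; last by move=> x; exact: IH (pP x).
by move=> x y; rewrite /diff !pP subr0.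
Qed.

Lemma shiftE x p : shift x p = fun y => p y + diff x p y.
Proof. by apply: funext => y; rewrite /shift /diff addrC subrK. Qed.

Lemma polymap_diff d x p : polymap d p -> polymap d (diff x p).
Proof. by case: d => [pP y|d pP]; [rewrite /diff !pP subr0|exact/polymapW]. Qed.

Lemma polymap_shift d x p : polymap d p -> polymap d (shift x p).
Proof.
by move=> pP; rewrite shiftE; apply: polymapD => //; exact: polymap_diff.
Qed.

(** The inverse of [shift x = 1 + diff x] on maps of degree less than [d],
that is the sum of the [(- diff x)^i] for [i < d], written in Horner form. *)
Fixpoint unshift (d : nat) x p : M -> A :=
  if d is e.+1 then fun y => p y - unshift e x (diff x p) y else fun=> 0.

Lemma polymap_unshift d x p : polymap d p -> polymap d (unshift d x p).
Proof.
elim: d p => [|d IH] p pP; first by [].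
by apply: (@polymapB d.+1) => //; exact/polymapW/IH.
Qed.

Lemma unshiftK d x p : polymap d p -> shift x (unshift d x p) = p.
Proof.
elim: d p => [|d IH] p pP; first by apply: funext => y; rewrite pP.
apply: funext => y; have /= /(congr1 (@^~ y)) := IH _ (pP x).
by rewrite /shift /= => ->; rewrite /diff opprB addrC subrK.
Qed.

Lemma shiftK d x p : polymap d p -> unshift d x (shift x p) = p.
Proof.
elim: d p => [|d IH] p pP; first by apply: funext => y; rewrite pP.
apply: funext => y /=.
by rewrite diff_shift IH // /diff /shift opprB addrC subrK.
Qed.

(** The alternating sum of the values of [p] at [y] times the products of the
subsequences of [s]: the value of [p] on the element y (x_1 - 1) ... (x_m - 1)
of the monoid ring. *)
Fixpoint deviation p (s : seq M) : M -> A :=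
  if s is x :: s' then diff x (deviation p s') else p.

Lemma polymap_deviation d p :
  (forall s y, size s = d -> deviation p s y = 0) -> polymap d p.
Proof.
elim: d p => [|d IH] p pP; first by move=> y; exact: (pP [::]).
move=> x; apply: IH => s y ss.
have -> : deviation (diff x p) s = deviation p (rcons s x).
  by elim: s {ss} => //= z s ->.
by apply: pP; rewrite size_rcons ss.
Qed.

(** In the monoid ring, y (x - 1) = (y x - 1) - (y - 1): a base point can be
absorbed in the first entry. *)
Lemma deviation_base d p :
  (forall s, size s = d.+1 -> deviation p s 1%g = 0) ->
  forall s y, size s = d.+1 -> deviation p s y = 0.
Proof.
move=> p0 [|x s] // y ss.
have := p0 ((y * x)%g :: s) ss; have := p0 (y :: s) ss.
rewrite /= /diff !mul1g => /eqP; by rewrite subr_eq0 => /eqP ->.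
Qed.

Lemma deviation1 p s y : 1%g \in s -> deviation p s y = 0.
Proof.
elim: s y => //= x s IH y; rewrite inE => /orP[/eqP <-|s1]; rewrite /diff.
  by rewrite mulg1 subrr.
by rewrite !IH // subrr.
Qed.

End PolynomialMaps.

Lemma deviation_natural (M M' : monoidType) (A A' : zmodType)
    (h : UMagmaMorphism.type M M') (t : {additive A -> A'})
    (p : M -> A) (p' : M' -> A') :
  (forall y, p' (h y) = t (p y)) ->
  forall s y, t (deviation p s y) = deviation p' (map h s) (h y).
Proof.
move=> pp'; elim=> [|x s IH] y //=.
by rewrite /diff raddfB !IH gmulfM.
Qed.

(** * Natural maps into polynomial functors *)

(** The entries of [s] are copied into distinct summands of the coproduct of
[n.+1] copies of [X].  The deviation at these copies lies in the cross-effect,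
as each retraction makes one entry trivial, and it is mapped to the deviation
at [s] by the codiagonal. *)
Lemma natural_polymap (C : pointed_category) (F : functor C Ab) (n : nat)
    (Phi : functor C Mon)
    (b : forall X, (Phi X : monoidType) -> (F X : zmodType)) :
  polynomial F n ->
  (forall t : (Phi zero : monoidType), t = 1%g) ->
  (forall X Y (h : hom X Y) t,
     b Y ((fmap Phi h : UMagmaMorphism.type _ _) t)
     = (fmap F h : {additive _ -> _}) (b X t)) ->
  forall X, polymap n.+1 (b X).
Proof.
move=> Fpol Phi0 bN X; apply: polymap_deviation; apply: deviation_base => s ss.
pose XX := fun _ : 'I_n.+1 => X.
pose nabla : hom (coprod XX) X := copair (fun=> idm X).
(* The i-th entry of s, placed in the i-th summand. *)
pose s' := [seq (fmap Phi (inj XX k) : UMagmaMorphism.type _ _) (nth 1%g s k)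
             | k <- enum 'I_n.+1].
have s'E : map (fmap Phi nabla : UMagmaMorphism.type _ _) s' = s.
  rewrite -map_comp; apply: (@eq_from_nth _ 1%g).
    by rewrite size_map size_enum_ord ss.
  move=> i; rewrite size_map size_enum_ord => ii.
  rewrite (nth_map ord0) ?size_enum_ord //=.
  rewrite -[LHS]/((fmap Phi nabla \oc fmap Phi (inj XX _)
    : UMagmaMorphism.type _ _) _).
  by rewrite -fmap_comp copair_inj fmap_id /= nth_enum_ord.
have : deviation (b (coprod XX)) s' 1%g = 0.
  suff : cross_effect F XX (deviation (b (coprod XX)) s' 1%g) by rewrite Fpol.
  move=> k; rewrite (deviation_natural (bN _ _ _)); apply: deviation1.
  apply/mapP; exists
    ((fmap Phi (inj XX k) : UMagmaMorphism.type _ _) (nth 1%g s k)).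
    by apply/mapP; exists k; rewrite ?mem_enum.
  rewrite -[RHS]/((fmap Phi (retraction XX k) \oc fmap Phi (inj XX k)
    : UMagmaMorphism.type _ _) _).
  rewrite -fmap_comp retraction_inj0 /zero_map fmap_comp /=.
  by rewrite [X in _ = fmap Phi _ X]Phi0 gmulf1.
move=> /(congr1 (fmap F nabla : {additive _ -> _})).
by rewrite (deviation_natural (bN _ _ _)) s'E raddf0 gmulf1.
Qed.

(** * The action of a free group on polynomial maps *)

(** A group of bijections of an arbitrary type, so that the universal property
of free groups applies to the invertible operators [shift x].  The inverse is
part of the data to keep the explicit formula [unshift] available. *)
Record bijection (V : Type) := Bijection {
  bij_fun :> V -> V;
  bij_inv : V -> V;
  bij_funK : cancel bij_fun bij_inv;
  bij_invK : cancel bij_inv bij_fun }.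

HB.instance Definition _ V := gen_eqMixin (bijection V).
HB.instance Definition _ V := gen_choiceMixin (bijection V).

Section BijectionGroup.
Variable V : Type.
Implicit Types f g h : bijection V.

Lemma bijection_ext f g : f =1 g -> f = g.
Proof.
case: f g => [f f' fK f'K] [g g' gK g'K] /= fg.
have e : f = g by exact: funext.
case: _ / e in gK g'K *.
have e' : f' = g' by apply: funext => x; rewrite -{1}(g'K x) fK.
case: _ / e' in gK g'K *.
by rewrite (Prop_irrelevance fK gK) (Prop_irrelevance f'K g'K).
Qed.

Definition bijection_one : bijection V :=
  @Bijection V id id (fun=> erefl) (fun=> erefl).
Definition bijection_mul f g : bijection V :=
  Bijection (can_comp (bij_funK f) (bij_funK g))
            (can_comp (bij_invK g) (bij_invK f)).
Definition bijection_inverse f : bijection V :=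
  Bijection (bij_invK f) (bij_funK f).

Lemma bijection_mulA : associative bijection_mul.
Proof. by move=> f g h; exact: bijection_ext. Qed.
Lemma bijection_mul1 : left_id bijection_one bijection_mul.
Proof. by move=> f; exact: bijection_ext. Qed.
Lemma bijection_mulr1 : right_id bijection_one bijection_mul.
Proof. by move=> f; exact: bijection_ext. Qed.
Lemma bijection_mulV :
  left_inverse bijection_one bijection_inverse bijection_mul.
Proof. by move=> f; apply: bijection_ext => x /=; rewrite bij_funK. Qed.
Lemma bijection_mulrV :
  right_inverse bijection_one bijection_inverse bijection_mul.
Proof. by move=> f; apply: bijection_ext => x /=; rewrite bij_invK. Qed.

HB.instance Definition _ := isGroup.Build (bijection V)
  bijection_mulA bijection_mul1 bijection_mulr1 bijection_mulV bijection_mulrV.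

End BijectionGroup.

Section ShiftAction.
Variables (M : monoidType) (A : zmodType) (d : nat).

Definition poly_map : Type := {p : M -> A | polymap d p}.

Lemma poly_map_ext (p q : poly_map) : sval p =1 sval q -> p = q.
Proof.
by case: p q => [p pP] [q qP] /= /funext pq; apply: eq_exist.
Qed.

Definition shift_poly (x : M) (p : poly_map) : poly_map :=
  exist _ _ (polymap_shift x (svalP p)).
Definition unshift_poly (x : M) (p : poly_map) : poly_map :=
  exist _ _ (polymap_unshift x (svalP p)).

Lemma shift_polyK x : cancel (shift_poly x) (unshift_poly x).
Proof. by move=> [p pP]; apply: poly_map_ext => y /=; rewrite shiftK. Qed.
Lemma unshift_polyK x : cancel (unshift_poly x) (shift_poly x).
Proof. by move=> [p pP]; apply: poly_map_ext => y /=; rewrite unshiftK. Qed.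

Definition shift_action (x : M) : bijection poly_map :=
  Bijection (shift_polyK x) (unshift_polyK x).

Lemma shift_action_morphism : monoid.monoid_morphism shift_action.
Proof.
split=> [|x y]; apply: bijection_ext => p; apply: poly_map_ext => z.
  by rewrite /= /shift mulg1.
by rewrite /= /shift mulgA.
Qed.

HB.instance Definition _ := isUMagmaMorphism.Build M (bijection poly_map)
  shift_action shift_action_morphism.

End ShiftAction.

Section Compatibility.
Variables (M M' : monoidType) (A A' : zmodType) (d : nat).
Variables (h : UMagmaMorphism.type M M') (t : {additive A -> A'}).

Definition intertwined (p : M -> A) (p' : M' -> A') : Prop :=
  forall y, p' (h y) = t (p y).

(** Operators on maps out of [M] and [M'] that correspond to each other under a
change of source [h] and of target [t].  Compatible pairs form a submonoid; it
is closed under the inverses used below because [unshift] is given by one and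
the same formula on both sides ([compatible_shiftV]). *)
Definition compatible (r : bijection (poly_map M A d))
    (r' : bijection (poly_map M' A' d)) : Prop :=
  forall p p', intertwined (sval p) (sval p') ->
  intertwined (sval (r p)) (sval (r' p')).

Lemma compatible1 : compatible 1%g 1%g.
Proof. by []. Qed.

Lemma compatibleM r s r' s' :
  compatible r r' -> compatible s s' -> compatible (r * s)%g (r' * s')%g.
Proof. by move=> rr' ss' p p' pp'; exact/rr'/ss'. Qed.

Lemma compatible_shift x :
  compatible (shift_action A d x) (shift_action A' d (h x)).
Proof. by move=> p p' pp' y /=; rewrite /shift -gmulfM pp'. Qed.

Lemma compatible_shiftV x :
  compatible (shift_action A d x)^-1%g (shift_action A' d (h x))^-1%g.
Proof.
move=> [p pP] [p' pP'] /=; elim: d p p' {pP pP'} => [|e IH] p p' pp' y /=.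
  by rewrite raddf0.
rewrite raddfB pp' (IH (diff x p)) // => z.
by rewrite /diff -gmulfM !pp' raddfB.
Qed.

End Compatibility.

(** * From free monoids to free groups *)

Definition completion l : UMagmaMorphism.type (free_monoid l) (free_group l) :=
  free_monoid_extend (@free_group_gen l).

Lemma completion_gen l (i : 'I_l) :
  completion l (free_monoid_gen i) = free_group_gen i.
Proof. exact: free_monoid_extend_gen. Qed.

Definition complete k l
    (h : UMagmaMorphism.type (free_monoid k) (free_monoid l)) :
    UMagmaMorphism.type (free_group k) (free_group l) :=
  free_group_extend (fun i => completion l (h (free_monoid_gen i))).

Lemma complete_gen k l
    (h : UMagmaMorphism.type (free_monoid k) (free_monoid l)) i :
  complete h (free_group_gen i) = completion l (h (free_monoid_gen i)).
Proof. exact: free_group_extend_gen. Qed.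

(** Naturality of the inclusion of the free monoid into the free group. *)
Lemma complete_completion k l
    (h : UMagmaMorphism.type (free_monoid k) (free_monoid l)) w :
  complete h (completion k w) = completion l (h w).
Proof.
have e : [the UMagmaMorphism.type _ _ of complete h \o completion k]
       = [the UMagmaMorphism.type _ _ of completion l \o h].
  by apply: free_monoid_gen_ext => i /=; rewrite completion_gen complete_gen.
exact: (congr1 (fun f : UMagmaMorphism.type _ _ => f w) e).
Qed.

Lemma complete_id k : complete (idm (k : mon)) = idm (k : gr).
Proof.
by apply: free_group_gen_ext => i; rewrite complete_gen completion_gen.
Qed.

Lemma complete_comp k l m (g : @hom mon l m) (f : @hom mon k l) :
  complete (g \oc f) = (complete g : @hom gr l m) \oc complete f.
Proof.
apply: free_group_gen_ext => i; rewrite complete_gen /=.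
by rewrite complete_gen complete_completion.
Qed.

Definition group_completion : functor mon gr :=
  @Functor mon gr (fun k => k) complete complete_id complete_comp.

Definition free_monoid_functor : functor mon Mon :=
  @Functor mon Mon (fun l => [the monoidType of free_monoid l])
    (fun _ _ f => f) (fun=> erefl) (fun _ _ _ _ _ => erefl).

Definition free_group_functor : functor gr Mon :=
  @Functor gr Mon (fun l => [the monoidType of free_group l])
    (fun _ _ f => f) (fun=> erefl) (fun _ _ _ _ _ => erefl).

(** * Finite powers of a monoid *)

Section Power.
Variable k : nat.

Section PowerMap.
Variables (M N : monoidType) (f : UMagmaMorphism.type M N).

Definition power_fun (t : {ffun 'I_k -> M}) : {ffun 'I_k -> N} :=
  [ffun j => f (t j)].

Lemma power_fun_morphism : monoid.monoid_morphism power_fun.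
Proof.
by split=> [|s t]; apply/ffunP => j; rewrite !ffunE ?gmulf1 ?gmulfM.
Qed.

HB.instance Definition _ :=
  isUMagmaMorphism.Build {ffun 'I_k -> M} {ffun 'I_k -> N} power_fun
    power_fun_morphism.

Definition power_map : UMagmaMorphism.type {ffun 'I_k -> M} {ffun 'I_k -> N} :=
  [the UMagmaMorphism.type _ _ of power_fun].

End PowerMap.

Definition power_functor : functor Mon Mon.
Proof.
refine (@Functor Mon Mon (fun M => [the monoidType of {ffun 'I_k -> M}])
  (fun M N f => power_map f) _ _).
- by move=> M; apply: monoid_hom_ext => t; apply/ffunP => j; rewrite !ffunE.
- move=> M N P g f; apply: monoid_hom_ext => t.
  by apply/ffunP => j; rewrite !ffunE.
Defined.

Section AtIndex.
Variables (M : monoidType) (j : 'I_k).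

Definition at_index (w : M) : {ffun 'I_k -> M} :=
  [ffun j' => if j' == j then w else 1%g].

Lemma at_index_morphism : monoid.monoid_morphism at_index.
Proof.
by split=> [|v w]; apply/ffunP => j'; rewrite !ffunE; case: ifP; rewrite ?mulg1.
Qed.

HB.instance Definition _ :=
  isUMagmaMorphism.Build M {ffun 'I_k -> M} at_index at_index_morphism.

End AtIndex.

Lemma prod_at_index (M : monoidType) (t : {ffun 'I_k -> M}) :
  (\prod_j at_index j (t j))%g = t.
Proof.
apply/ffunP => i.
rewrite (big_morph (fun s : {ffun 'I_k -> M} => s i)
  (id1 := 1%g) (op1 := *%g)%g).
- under eq_bigr do rewrite ffunE eq_sym.
  by rewrite -big_mkcond big_pred1_eq.
- by move=> s s'; rewrite ffunE.
- by rewrite ffunE.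
Qed.

Lemma power_at_index (M N : monoidType) (f : UMagmaMorphism.type M N) j w :
  power_map f (at_index j w) = at_index j (f w).
Proof. by apply/ffunP => j'; rewrite !ffunE; case: ifP; rewrite ?gmulf1. Qed.

End Power.

Lemma at_indexV k (G : groupType) (j : 'I_k) (w : G) :
  at_index j w^-1%g = (at_index j w)^-1%g.
Proof. exact: gmulfV. Qed.

(** * Uniqueness of extensions *)

Lemma free_group_letter_prod l (w : free_group l) :
  w = (\prod_(a <- val w) letter_val (@free_group_gen l) a)%g.
Proof.
have e : [the UMagmaMorphism.type _ _ of @idfun (free_group l)]
       = free_group_extend (@free_group_gen l).
  by apply: free_group_gen_ext => i; rewrite free_group_extend_gen.
exact: (congr1 (fun f : UMagmaMorphism.type _ _ => f w) e).
Qed.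

Section Uniqueness.
Variables (k l : nat) (A : zmodType).
Let M := {ffun 'I_k -> free_monoid l}.
Let G := {ffun 'I_k -> free_group l}.
Let c : UMagmaMorphism.type M G := power_map k (completion l).

(** The polynomial maps that vanish on the submonoid; the aim is to show that
they form a set stable under translation by the whole group, so that their
values at all points, being values at 1 of translates, are 0. *)
Definition vanishing d (p : G -> A) : Prop :=
  polymap d p /\ forall t : M, p (c t) = 0.

Definition stabilizer d (g : G) : Prop :=
  forall p, vanishing d p -> vanishing d (shift g p).

Lemma stabilizer1 d : stabilizer d 1%g.
Proof.
move=> p; have -> // : shift 1%g p = p.
by apply: funext => y; rewrite /shift mulg1.
Qed.

Lemma stabilizerM d g g' :
  stabilizer d g -> stabilizer d g' -> stabilizer d (g * g')%g.
Proof.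
move=> gS g'S p pV; have -> : shift (g * g')%g p = shift g (shift g' p).
  by apply: funext => y; rewrite /shift mulgA.
exact/gS/g'S.
Qed.

Lemma stabilizer_completion d t : stabilizer d (c t).
Proof.
move=> p [pP p0]; split; first exact: polymap_shift.
by move=> u; rewrite /shift -gmulfM p0.
Qed.

(** Translation by the inverse of [c t] is [unshift d (c t)], which involves
only translations by powers of [c t]. *)
Lemma stabilizer_completionV d t : stabilizer d (c t)^-1%g.
Proof.
move=> p [pP p0]; have -> : shift (c t)^-1%g p = unshift d (c t) p.
  rewrite -[in LHS](unshiftK (c t) pP).
  by apply: funext => y; rewrite /shift mulgVK.
split; first exact: polymap_unshift.
elim: d p {pP} p0 => [|d IH] p p0 u //=.
by rewrite p0 IH ?subr0 // => v; rewrite /diff -gmulfM !p0 subr0.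
Qed.

(** The group is generated by the letters placed in one coordinate and by
their inverses. *)
Lemma stabilizer_all d g : stabilizer d g.
Proof.
rewrite -(prod_at_index g).
apply: (big_ind (stabilizer d) (@stabilizer1 d) (@stabilizerM d)) => j _.
rewrite (free_group_letter_prod (g j)) gmulf_prod.
apply: (big_ind (stabilizer d) (@stabilizer1 d) (@stabilizerM d)) => -[i b] _.
have eji : at_index j (free_group_gen i) = c (at_index j (free_monoid_gen i)).
  by rewrite power_at_index completion_gen.
rewrite /letter_val /=; case: b; rewrite ?at_indexV eji.
  exact: stabilizer_completionV.
exact: stabilizer_completion.
Qed.

Lemma polymap_completion_eq0 d (p : G -> A) :
  polymap d p -> (forall t : M, p (c t) = 0) -> forall g, p g = 0.
Proof.
move=> pP p0 g; have [_ /(_ 1%g)] := stabilizer_all g (conj pP p0).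
by rewrite /shift gmulf1 mul1g.
Qed.

End Uniqueness.

(** * Extension of natural families *)

Definition mon_natural (F : functor mon Ab) (k : nat)
    (b : forall l : nat, @hom gr k l -> (F l : zmodType)) : Prop :=
  forall l m (h : @hom mon l m) f,
    b m (fmap group_completion h \oc f)
    = (fmap F h : {additive _ -> _}) (b l f).

Section Extension.
Variables (n : nat) (F : functor mon Ab).
Hypothesis Fpol : polynomial F n.
Variable k : nat.

(** Both families consist of polynomial maps on the group of [k]-tuples of
reduced words, and by naturality they agree on the [k]-tuples of positive words,
these being the images of the identity under monoid morphisms. *)
Lemma natural_family_unique
    (b b' : forall l : nat, @hom gr k l -> (F l : zmodType)) :
  mon_natural b -> mon_natural b' ->
  b k (idm (k : gr)) = b' k (idm (k : gr)) -> forall l f, b l f = b' l f.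
Proof.
move=> bN b'N bb' l f.
(* The bijection between tuples of reduced words and morphisms. *)
pose e m (t : {ffun 'I_k -> free_group m}) : @hom gr k m := free_group_extend t.
pose Phi := functor_comp (power_functor k)
              (functor_comp free_group_functor group_completion).
have eN m m' (h : @hom mon m m') t :
    e m' (power_map k (complete h) t) = fmap group_completion h \oc e m t.
  apply: free_group_gen_ext => i; rewrite /= free_group_extend_gen ffunE.
  by rewrite free_group_extend_gen.
have Phi0 (t : (Phi zero : monoidType)) : t = 1%g.
  by apply/ffunP => j; rewrite ffunE; exact: (@base_uniq free_groups).
have bP m : polymap n.+1 (fun t => b m (e m t)).
  apply: (@natural_polymap mon F n Phi (fun X t => b X (e X t)) Fpol Phi0).
  by move=> X Y h t; rewrite -bN -eN.
have b'P m : polymap n.+1 (fun t => b' m (e m t)).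
  apply: (@natural_polymap mon F n Phi (fun X t => b' X (e X t)) Fpol Phi0).
  by move=> X Y h t; rewrite -b'N -eN.
have := polymap_completion_eq0 (polymapB (bP l) (b'P l)).
have -> : f = e l [ffun j => (f : UMagmaMorphism.type _ _) (free_group_gen j)].
  by apply: free_group_gen_ext => i; rewrite free_group_extend_gen ffunE.
move=> H; apply/eqP; rewrite -subr_eq0; apply/eqP; apply: H => t.
have -> : e l (power_map k (completion l) t)
    = fmap group_completion (free_monoid_extend t : @hom mon k l)
      \oc idm (k : gr).
  apply: free_group_gen_ext => i; rewrite /= free_group_extend_gen ffunE.
  by rewrite complete_gen free_monoid_extend_gen.
by rewrite bN b'N bb' subrr.
Qed.

Variable x : (F k : zmodType).

Definition orbit_map l (t : {ffun 'I_k -> free_monoid l}) : (F l : zmodType) :=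
  (fmap F (free_monoid_extend t : @hom mon k l) : {additive _ -> _}) x.

Lemma orbit_map_natural l m (h : @hom mon l m) t :
  orbit_map (power_map k h t) = (fmap F h : {additive _ -> _}) (orbit_map t).
Proof.
rewrite /orbit_map.
have -> : free_monoid_extend (power_map k h t)
    = h \oc (free_monoid_extend t : @hom mon k l).
  apply: free_monoid_gen_ext => i; rewrite /= free_monoid_extend_gen ffunE.
  by rewrite free_monoid_extend_gen.
by rewrite fmap_comp.
Qed.

Lemma polymap_orbit_map l : polymap n.+1 (@orbit_map l).
Proof.
apply: (@natural_polymap mon F n
  (functor_comp (power_functor k) free_monoid_functor) orbit_map Fpol).
- move=> t; apply/ffunP => j; rewrite ffunE.
  exact: (@base_uniq free_monoids).
- by move=> X Y h t; exact: orbit_map_natural.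
Qed.

Let space l := poly_map {ffun 'I_k -> free_monoid l} (F l : zmodType) n.+1.

(** The action of the free group on polynomial maps in the [j]-th variable. *)
Definition word_action l (j : 'I_k) :
    UMagmaMorphism.type (free_group l) (bijection (space l)) :=
  free_group_extend
    (fun i => shift_action (F l : zmodType) n.+1
                (at_index j (free_monoid_gen i))).

Lemma word_action_completion l j (w : free_monoid l) :
  word_action l j (completion l w) = shift_action _ _ (at_index j w).
Proof.
have e : [the UMagmaMorphism.type _ _ of word_action l j \o completion l]
  = [the UMagmaMorphism.type _ _ of
       shift_action (F l : zmodType) n.+1 \o at_index j].
  apply: free_monoid_gen_ext => i /=.
  by rewrite completion_gen free_group_extend_gen.
exact: (congr1 (fun f : UMagmaMorphism.type _ _ => f w) e).
Qed.

(** Both sides, as functions of [w], are products over the letters of [w] of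
translations or of their inverses. *)
Lemma word_action_compatible l m (h : @hom mon l m) j w :
  compatible (power_map k h) (fmap F h)
    (word_action l j w) (word_action m j (complete h w)).
Proof.
have -> : word_action m j (complete h w) = free_group_extend (fun i =>
    shift_action (F m : zmodType) n.+1
      (power_map k h (at_index j (free_monoid_gen i)))) w.
  pose f := [the UMagmaMorphism.type _ _ of word_action m j \o complete h].
  rewrite -[LHS]/(f w); congr (fun f : UMagmaMorphism.type _ _ => f w).
  apply: free_group_gen_ext => i; rewrite free_group_extend_gen /=.
  by rewrite complete_gen word_action_completion power_at_index.
apply: (big_ind2 (compatible (power_map k h) (fmap F h))).
- exact: compatible1.
- by move=> *; exact: compatibleM.
- move=> [i []] _; rewrite /letter_val /=; first exact: compatible_shiftV.
  exact: compatible_shift.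
Qed.

(** The orbit map of [x], translated by all the coordinates of [g], is evaluated
at 1: for a tuple of positive words this returns its value at that tuple. *)
Definition extended_orbit_map l (g : {ffun 'I_k -> free_group l}) :
    (F l : zmodType) :=
  sval ((\prod_j word_action l j (g j))%g
          (exist _ _ (@polymap_orbit_map l))) 1%g.

Lemma extended_orbit_map_completion l (t : {ffun 'I_k -> free_monoid l}) :
  extended_orbit_map (power_map k (completion l) t) = orbit_map t.
Proof.
rewrite /extended_orbit_map.
under eq_bigr do rewrite ffunE word_action_completion.
by rewrite -gmulf_prod prod_at_index /= /shift mul1g.
Qed.

Lemma extended_orbit_map_natural l m (h : @hom mon l m) g :
  extended_orbit_map (power_map k (complete h) g)
  = (fmap F h : {additive _ -> _}) (extended_orbit_map g).
Proof.
have : compatible (power_map k h) (fmap F h) (\prod_j word_action l j (g j))%g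
    (\prod_j word_action m j (power_map k (complete h) g j))%g.
  apply: (big_ind2 (compatible (power_map k h) (fmap F h))).
  - exact: compatible1.
  - by move=> *; exact: compatibleM.
  - by move=> j _; rewrite ffunE; exact: word_action_compatible.
move=> /(_ (exist _ _ (@polymap_orbit_map l))
           (exist _ _ (@polymap_orbit_map m))).
move=> /(_ (orbit_map_natural h) 1%g).
by rewrite gmulf1.
Qed.

Lemma natural_family_exists :
  exists b : forall l : nat, @hom gr k l -> (F l : zmodType),
    b k (idm (k : gr)) = x /\ mon_natural b.
Proof.
exists (fun l f =>
  extended_orbit_map
    [ffun j => (f : UMagmaMorphism.type _ _) (free_group_gen j)]).
split.
  (* The identity corresponds to the tuple of generators, a positive one. *)
  have -> : [ffun j => (idm (k : gr) : UMagmaMorphism.type _ _)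
                         (free_group_gen j)]
      = power_map k (completion k) [ffun j => free_monoid_gen j].
    by apply/ffunP => j; rewrite !ffunE completion_gen.
  rewrite extended_orbit_map_completion /orbit_map.
  have -> : free_monoid_extend [ffun j => free_monoid_gen j] = idm (k : mon).
    by apply: free_monoid_gen_ext => i; rewrite free_monoid_extend_gen ffunE.
  by rewrite fmap_id.
move=> l m h f; rewrite -extended_orbit_map_natural; congr extended_orbit_map.
by apply/ffunP => j; rewrite !ffunE.
Qed.

End Extension.

(** * Extension of polynomial functors *)

Section ExtendFunctor.
Variables (n : nat) (F : functor mon Ab).
Hypothesis Fpol : polynomial F n.

Definition extended_value k (x : (F k : zmodType)) :
    forall l : nat, @hom gr k l -> (F l : zmodType) :=
  sval (cid (natural_family_exists Fpol x)).

Lemma extended_value_id k (x : (F k : zmodType)) :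
  extended_value x (idm (k : gr)) = x.
Proof. by rewrite /extended_value; case: cid => b []. Qed.

Lemma extended_value_natural k (x : (F k : zmodType)) :
  mon_natural (extended_value x).
Proof. by rewrite /extended_value; case: cid => b []. Qed.

Lemma extended_value_unique k (x : (F k : zmodType))
    (b : forall l : nat, @hom gr k l -> (F l : zmodType)) :
  mon_natural b -> b k (idm (k : gr)) = x ->
  forall l f, extended_value x f = b l f.
Proof.
move=> bN bx; apply: (natural_family_unique Fpol _ bN).
  exact: extended_value_natural.
by rewrite extended_value_id bx.
Qed.

Section Morphism.
Variables (k l : nat) (f : @hom gr k l).

Definition extended_fun (x : (F k : zmodType)) : (F l : zmodType) :=
  extended_value x f.

Lemma extended_fun_additive : zmod_morphism extended_fun.
Proof.
move=> x y; rewrite /extended_fun.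
apply: (extended_value_unique
  (b := fun m g => extended_value x g - extended_value y g)).
  by move=> m m' h g; rewrite raddfB !extended_value_natural.
by rewrite !extended_value_id.
Qed.

HB.instance Definition _ := GRing.isZmodMorphism.Build _ _ extended_fun
  extended_fun_additive.

End Morphism.

Definition extended_functor : functor gr Ab.
Proof.
refine (@Functor gr Ab (fobj F)
  (fun k l f => [the {additive _ -> _} of @extended_fun k l f]) _ _).
- by move=> k; apply: additive_ext => x; exact: extended_value_id.
- move=> k l m g f; apply: additive_ext => x /=.
  apply/esym/(extended_value_unique
    (b := fun m g => extended_value x (g \oc f))).
    by move=> p q h f'; rewrite -extended_value_natural compA.
  by rewrite comp_idl.
Defined.

End ExtendFunctor.

(** Functors with convertible object maps are compared without any transport. *)
Lemma functor_eq (C D : category) (F : functor C D)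
    (fm : forall X Y, hom X Y -> hom (F X) (F Y)) fm1 fmM :
  (forall X Y (f : hom X Y), fm X Y f = fmap F f) ->
  @Functor C D (fobj F) fm fm1 fmM = F.
Proof.
case: F fm fm1 fmM => o m m1 mM /= fm fm1 fmM fmE.
have e : fm = m.
  apply: functional_extensionality_dep => X.
  apply: functional_extensionality_dep => Y; exact: funext.
by case: _ / e in m1 mM fmE *; congr Functor; exact: Prop_irrelevance.
Qed.

Lemma restrict_extended_functor n (F : functor mon Ab) (Fpol : polynomial F n) :
  functor_comp (extended_functor Fpol) group_completion = F.
Proof.
apply: functor_eq => k l h; apply: additive_ext => x /=.
have := extended_value_natural Fpol x h (idm (k : gr)).
by rewrite comp_idr extended_value_id.
Qed.

Lemma extended_functor_restrict n (F : functor gr Ab)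
    (Fpol : polynomial (functor_comp F group_completion) n) :
  extended_functor Fpol = F.
Proof.
apply: functor_eq => k l f; apply: additive_ext => x /=.
apply: (@extended_value_unique n _ Fpol k x
  (fun l f => (fmap F f : {additive _ -> _}) x)).
  by move=> l' m h g; rewrite fmap_comp.
by rewrite fmap_id.
Qed.

(** Applied to a fixed element, the two composites are families in [f] which are
natural for monoid morphisms and agree at the identity. *)
Lemma restrict_nat_trans_natural n (F G : functor gr Ab)
    (s : nat_trans (functor_comp F group_completion)
                   (functor_comp G group_completion)) :
  polynomial (functor_comp G group_completion) n ->
  forall (k l : gr) (f : hom k l), s l \oc fmap F f = fmap G f \oc s k.
Proof.
move=> Gpol k l f; apply: additive_ext => x.
apply: (@natural_family_unique n _ Gpol k
  (fun l f => (s l \oc fmap F f : {additive _ -> _}) x)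
  (fun l f => (fmap G f \oc s k : {additive _ -> _}) x)) 
  => [l' m h g|l' m h g|].
- rewrite fmap_comp compA.
  by rewrite (naturality s h : s m \oc fmap F (fmap group_completion h) = _).
- by rewrite fmap_comp -compA.
- by rewrite !fmap_id.
Qed.

(** * Cross-effects and restriction *)

Lemma group_completion_inj m (X : 'I_m -> nat) i :
  fmap group_completion (@inj mon m X i) = @inj gr m X i.
Proof.
apply: free_group_gen_ext => j.
rewrite /= complete_gen free_monoid_extend_gen free_group_extend_gen.
exact: completion_gen.
Qed.

Lemma group_completion_zero_map (k l : nat) :
  fmap group_completion (@zero_map mon k l) = @zero_map gr k l.
Proof.
by rewrite /zero_map fmap_comp; congr (_ \oc _);
  [exact: from_zero_uniq|exact: to_zero_uniq].
Qed.

Lemma group_completion_retraction m (X : 'I_m.+1 -> nat) k :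
  fmap group_completion (@retraction mon m X k) = @retraction gr m X k.
Proof.
apply: copair_uniq => i.
have -> : (fmap group_completion (@retraction mon m X k) : hom _ _)
            \oc @inj gr _ X i
    = fmap group_completion (@retraction mon m X k \oc @inj mon _ X i).
  by rewrite fmap_comp group_completion_inj.
case: (unliftP k i) => [j ->|->].
  rewrite (@retraction_inj mon) (@retraction_inj gr).
  exact: group_completion_inj.
rewrite (@retraction_inj0 mon) (@retraction_inj0 gr).
exact: group_completion_zero_map.
Qed.

Lemma cross_effect_restrict (F : functor gr Ab) m (X : 'I_m.+1 -> nat) :
  cross_effect (functor_comp F group_completion) (X : 'I_m.+1 -> mon)
  = cross_effect F (X : 'I_m.+1 -> gr).
Proof.
apply/seteqP; split=> x xX k.
  by rewrite -group_completion_retraction; exact: xX.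
by have := xX k; rewrite -group_completion_retraction.
Qed.

Lemma polynomial_restrict (F : functor gr Ab) n :
  polynomial (functor_comp F group_completion) n <-> polynomial F n.
Proof. by split=> FP X; have := FP X; rewrite cross_effect_restrict. Qed.

(** * Isomorphisms of categories *)

Section HomCast.
Variable C : category.

(** Transport of a morphism along equalities of its source and target: objects
related by [P] and its inverse on objects are equal but not convertible. *)
Definition hom_cast (X X' Y Y' : C) (eX : X = X') (eY : Y = Y')
    (f : hom X Y) : hom X' Y' :=
  ecast Z (hom Z Y') eX (ecast Z (hom X Z) eY f).

Lemma hom_cast_id (X X' : C) (e : X = X') : hom_cast e e (idm X) = idm X'.
Proof. by case: _ / e. Qed.

Lemma hom_cast_comp (X X' Y Y' Z Z' : C)
    (eX : X = X') (eY : Y = Y') (eZ : Z = Z') (g : hom Y Z) (f : hom X Y) :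
  hom_cast eX eZ (g \oc f) = hom_cast eY eZ g \oc hom_cast eX eY f.
Proof. by case: _ / eX; case: _ / eY; case: _ / eZ. Qed.

Lemma hom_castK (X X' Y Y' : C) (eX : X = X') (eY : Y = Y')
    (eX' : X' = X) (eY' : Y' = Y) (f : hom X Y) :
  hom_cast eX' eY' (hom_cast eX eY f) = f.
Proof.
case: _ / eX in eX' *; case: _ / eY in eY' *.
by rewrite (Prop_irrelevance eX' erefl) (Prop_irrelevance eY' erefl).
Qed.

End HomCast.

Lemma fmap_hom_cast (C D : category) (F : functor C D) (X X' Y Y' : C)
    (eX : X = X') (eY : Y = Y') (f : hom X Y) :
  fmap F (hom_cast eX eY f) = hom_cast (congr1 F eX) (congr1 F eY) (fmap F f).
Proof. by case: _ / eX; case: _ / eY. Qed.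

Lemma functor_ext (C D : category) (F G : functor C D)
    (e : forall X, F X = G X) :
  (forall X Y (f : hom X Y), hom_cast (e X) (e Y) (fmap F f) = fmap G f) ->
  F = G.
Proof.
case: F G e => [o m m1 mM] [o' m' m1' mM'] /= e.
have eo : o = o' by exact: funext.
case: _ / eo in m' m1' mM' e * => me.
apply: (@functor_eq C D (Functor m1' mM')) => X Y f /=.
by rewrite -me (Prop_irrelevance (e X) erefl) (Prop_irrelevance (e Y) erefl).
Qed.

(** The inverse on morphisms is that of [P] after transport to objects in the
image of [P]; since [P] is faithful, its functoriality and the fact that it is
inverse to [P] need only be verified after applying [P]. *)
Lemma isomorphic_categories_fully_faithful (C D : category) (P : functor C D)
    (q : D -> C) (fq : forall X Y, hom (P X) (P Y) -> hom X Y) :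
  cancel P q -> cancel q P ->
  (forall X Y, cancel (@fmap C D P X Y) (@fq X Y)) ->
  (forall X Y, cancel (@fq X Y) (@fmap C D P X Y)) ->
  isomorphic_categories C D.
Proof.
move=> PK qK fK fqK.
have fI X Y : injective (@fmap C D P X Y) := can_inj (fK X Y).
pose qm (X Y : D) (f : hom X Y) : hom (q X) (q Y) :=
  fq _ _ (hom_cast (esym (qK X)) (esym (qK Y)) f).
have qm1 X : qm X X (idm X) = idm (q X).
  by apply: fI; rewrite fqK fmap_id hom_cast_id.
have qmM X Y Z (g : hom Y Z) (f : hom X Y) :
    qm X Z (g \oc f) = qm Y Z g \oc qm X Y f.
  by apply: fI; rewrite fmap_comp !fqK -hom_cast_comp.
pose Q := Functor qm1 qmM; exists P, Q; split.
  apply: (@functor_ext C C (functor_comp Q P) (functor_id C) PK) => X Y f /=.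
  apply: fI.
  by rewrite fmap_hom_cast fqK hom_castK.
apply: (@functor_ext D D (functor_comp P Q) (functor_id D) qK) => X Y f /=.
by rewrite fqK hom_castK.
Qed.

Section Restriction.
Variable n : nat.

Definition restrict_pol (F : Pol n gr) : Pol n mon :=
  exist _ (functor_comp (sval F) group_completion)
    (conj (svalP F).1 (proj2 (polynomial_restrict _ _) (svalP F).2)).

Definition extend_pol (F : Pol n mon) : Pol n gr.
Proof.
exists (extended_functor (svalP F).2); split; first exact: (svalP F).1.
apply/polynomial_restrict; rewrite restrict_extended_functor.
exact: (svalP F).2.
Defined.

Lemma restrict_polK : cancel restrict_pol extend_pol.
Proof.
by move=> [F FP]; apply: eq_exist => /=; exact: extended_functor_restrict.
Qed.

Lemma extend_polK : cancel extend_pol restrict_pol.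
Proof.
by move=> [F FP]; apply: eq_exist => /=; exact: restrict_extended_functor.
Qed.

Definition restrict_nat (F G : functor gr Ab) (s : nat_trans F G) :
    nat_trans (functor_comp F group_completion)
              (functor_comp G group_completion) :=
  @NatTrans _ _ (functor_comp F group_completion)
                (functor_comp G group_completion)
    (fun X => s X) (fun X Y f => naturality s (fmap group_completion f)).

Definition extend_nat (F G : Pol n gr)
    (s : hom (restrict_pol F) (restrict_pol G)) : hom F G :=
  NatTrans (restrict_nat_trans_natural s (svalP (restrict_pol G)).2).

Definition restriction_functor : functor (Pol n gr) (Pol n mon).
Proof.
refine (@Functor (Pol n gr) (Pol n mon) restrict_pol
  (fun F G s => restrict_nat s) _ _).
- by move=> F; exact: nat_trans_ext.
- by move=> F G H t s; exact: nat_trans_ext.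
Defined.

End Restriction.

Theorem theorem0p2 (n : nat) : isomorphic_categories (Pol n mon) (Pol n gr).
Proof.
suff [P [Q [QP PQ]]] : isomorphic_categories (Pol n gr) (Pol n mon).
  by exists Q, P.
apply: (@isomorphic_categories_fully_faithful _ _ (restriction_functor n)
  (@extend_pol n) (@extend_nat n)).
- exact: restrict_polK.
- exact: extend_polK.
- by move=> F G s; exact: nat_trans_ext.
- by move=> F G s; exact: nat_trans_ext.
Qed.
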